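(* No algorithm can solve reachable-APSD enumeration with delay in $O(\overline{\Delta})$ and preprocessing in $O(n+m)$ unless the product of two $d\times d$ Boolean matrices can be computed in $O(d^2)$ total time.
   Context: Input: a graph $G=(V,E)$ with $n$ vertices and $m$ edges (unweighted, or with non-negative integer weights), given as read-only adjacency lists in the word RAM model. $\overline{\Delta}$ is the average (out-)degree. $d(u,v)$ is the shortest distance ($\infty$ if unreachable). Reachable-APSD enumeration: output each triple $(u,v,d(u,v))$ with $d(u,v)<\infty$ exactly once and no others. Preprocessing: time before enumeration starts; delay: maximum time to the first output after preprocessing, between consecutive outputs, and until termination is signalled. *)

(* Defs.v *)
From HB Require Import structures.
From mathcomp Require Import all_boot all_order all_algebra.

Set Implicit Arguments.
Unset Strict Implicit.
Unset Printing Implicit Defensive.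

(** * Word RAM

    The word size [w] is a parameter of the execution, not of the program.
    A program addresses a read-only input, made of finitely many arrays, and
    registers and arrays of read-write memory, all initially 0.  Registers and
    read-write arrays are named by constants of the program text, so that a
    program uses only finitely many of them (each array has [2 ^ w] cells);
    array cells are addressed by words.  Every instruction takes unit time. *)

Inductive binop :=
  OpAdd | OpSub | OpMul | OpDiv | OpAnd | OpOr | OpXor | OpShl | OpShr
| OpLt | OpEq.

Definition eval_binop (w : nat) (o : binop) (x y : nat) : nat :=
  match o with
  | OpAdd => x + y
  | OpSub => x + (2 ^ w - y)
  | OpMul => x * y
  | OpDiv => x %/ y
  | OpAnd => Nat.land x y
  | OpOr => Nat.lor x y
  | OpXor => Nat.lxor x y
  | OpShl => x * 2 ^ y
  | OpShr => x %/ 2 ^ y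
  | OpLt => (x < y : bool)
  | OpEq => (x == y : bool)
  end %% 2 ^ w.

Inductive instr :=
| IConst (r c : nat)
| IBinop (o : binop) (r r1 r2 : nat)
| IRead (r a i : nat)
| ILoad (r a i : nat)
| IStore (a i r : nat)
| IJz (r l : nat)
| IEmit (r1 r2 r3 : nat)
| IHalt.

Definition program := seq instr.

(* Read-only input; cells outside its arrays read as 0. *)
Definition input := seq (seq nat).

Record config := Config {
  pc : nat;
  regs : nat -> nat;
  memory : nat -> nat -> nat
}.

Definition init_config : config := Config 0 (fun=> 0) (fun _ _ => 0).

Definition set_reg (s : config) (r x : nat) : config :=
  Config (pc s).+1 (fun r' => if r' == r then x else regs s r') (memory s).

Definition set_mem (s : config) (a i x : nat) : config :=
  Config (pc s).+1 (regs s)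
    (fun a' i' => if (a' == a) && (i' == i) then x else memory s a' i').

Definition fetch (P : program) (s : config) : instr := nth IHalt P (pc s).

Definition halted (P : program) (s : config) : bool :=
  if fetch P s is IHalt then true else false.

Definition step (w : nat) (P : program) (inp : input) (s : config) : config :=
  match fetch P s with
  | IConst r c => set_reg s r (c %% 2 ^ w)
  | IBinop o r r1 r2 => set_reg s r (eval_binop w o (regs s r1) (regs s r2))
  | IRead r a i =>
      set_reg s r (nth 0 (nth [::] inp a) (regs s i) %% 2 ^ w)
  | ILoad r a i => set_reg s r (memory s a (regs s i))
  | IStore a i r => set_mem s a (regs s i) (regs s r)
  | IJz r l =>
      Config (if regs s r == 0 then l else (pc s).+1) (regs s) (memory s)
  | IEmit _ _ _ => Config (pc s).+1 (regs s) (memory s)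
  | IHalt => s
  end.

Definition config_at (w : nat) (P : program) (inp : input) (t : nat) : config :=
  iter t (step w P inp) init_config.

Definition halts_at (w : nat) (P : program) (inp : input) (T : nat) : Prop :=
  halted P (config_at w P inp T) /\
  (forall t, t < T -> ~~ halted P (config_at w P inp t)).

Definition emission (P : program) (s : config) : option (nat * nat * nat) :=
  if fetch P s is IEmit r1 r2 r3 then Some (regs s r1, regs s r2, regs s r3)
  else None.

Definition output_times (w : nat) (P : program) (inp : input) (T : nat) :
    seq nat :=
  [seq t <- iota 0 T | emission P (config_at w P inp t)].

Definition outputs (w : nat) (P : program) (inp : input) (T : nat) :
    seq (nat * nat * nat) :=
  pmap (fun t => emission P (config_at w P inp t)) (iota 0 T).

(* The delay of a run with outputs at times ts that ends at time T, when the
   preprocessing ends at time p. *)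
Definition delay (p : nat) (ts : seq nat) (T : nat) : nat :=
  \max_(g <- pairmap (fun s t => t - s) p (rcons ts T)) g.

(* Words have at least kappa * log2 N bits.  An algorithm in the word RAM
   model, with words of Omega (log N) bits on inputs of size N, is a program
   together with such a constant kappa. *)
Definition wide_enough (kappa N w : nat) : Prop := N ^ kappa <= 2 ^ w.

(** * Graphs given by adjacency lists *)

(* Undirected graphs are symmetric directed graphs; [weight u v] is meaningful
   only on edges, and [adj u] lists the neighbours of [u] in arbitrary order. *)
Record graph := Graph {
  nvert : nat;
  edge : rel 'I_nvert;
  weight : 'I_nvert -> 'I_nvert -> nat;
  adj : 'I_nvert -> seq 'I_nvert
}.

Definition valid_graph (directed weighted : bool) (G : graph) : Prop :=
  [/\ 0 < nvert G,
      irreflexive (@edge G),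
      forall u : 'I_(nvert G), uniq (adj u) /\ adj u =i edge u,
      ~~ directed -> symmetric (@edge G) /\
                     (forall u v : 'I_(nvert G), weight u v = weight v u)
    & ~~ weighted -> forall u v : 'I_(nvert G), edge u v -> weight u v = 1].

Definition num_edges (directed : bool) (G : graph) : nat :=
  #|[set e : 'I_(nvert G) * 'I_(nvert G)
      | edge e.1 e.2 && (directed || (e.1 < e.2))]|.

Definition avg_degree (G : graph) : rat :=
  ((\sum_(u < nvert G) #|edge u|)%:R / (nvert G)%:R)%R.

Definition max_weight (G : graph) : nat :=
  \max_(u < nvert G) \max_(v < nvert G | edge u v) weight u v.

Fixpoint walk_weight (G : graph) (u : 'I_(nvert G)) (p : seq 'I_(nvert G)) :
    nat :=
  if p is v :: p' then weight u v + walk_weight v p' else 0.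

(* [d(u, v) = k], with k finite. *)
Definition is_dist (G : graph) (u v : 'I_(nvert G)) (k : nat) : Prop :=
  (exists p, [/\ path (@edge G) u p, last u p = v & walk_weight u p = k]) /\
  (forall p, path (@edge G) u p -> last u p = v -> k <= walk_weight u p).

(* Array 0 holds n.  The adjacency list of the vertex u occupies the cells of
   array 2 from [start u] (included) to [start u.+1] (excluded), where [start]
   is array 1, of length n + 1.  For weighted graphs, array 3 holds the weights
   of the edges, in the same positions as in array 2. *)
Definition encode_graph (weighted : bool) (G : graph) : input :=
  let V := enum 'I_(nvert G) in
  [:: [:: nvert G];
      0 :: scanl addn 0 [seq size (@adj G u) | u <- V];
      flatten [seq [seq val v | v <- @adj G u] | u <- V]] ++
  (if weighted then [:: flatten [seq [seq weight u v | v <- @adj G u] | u <- V]]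
   else [::]).

(** * Reachable-APSD enumeration *)

Definition enumerates_reachable_apsd (G : graph) (w : nat) (P : program)
    (inp : input) (T : nat) : Prop :=
  uniq (outputs w P inp T) /\
  (forall x y k : nat, (x, y, k) \in outputs w P inp T <->
     exists u v : 'I_(nvert G), [/\ x = u, y = v & is_dist u v k]).

(* Every step takes positive time whereas the average degree can be 0, so the
   delay bound O(avg_degree) is read as O(1 + avg_degree).  The size of an
   input includes the maximum edge weight, so that the numbers to be handled
   fit in a word. *)
Definition solves_reachable_apsd (directed weighted : bool) (P : program) :
    Prop :=
  exists kappa c : nat, forall (G : graph) (w : nat),
    valid_graph directed weighted G ->
    wide_enough kappa (nvert G + num_edges directed G + max_weight G + 2) w ->
    let inp := encode_graph weighted G in
    exists T p : nat,
      [/\ halts_at w P inp T,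
          enumerates_reachable_apsd G w P inp T,
          p <= T /\ all (leq p) (output_times w P inp T),
          p <= c * (nvert G + num_edges directed G)
        & ((delay p (output_times w P inp T) T)%:R
             <= c%:R * (1 + avg_degree G) :> rat)%R].

(** * Boolean matrix multiplication *)

Definition bool_mulmx (d : nat) (A B : 'M[bool]_d) : 'M[bool]_d :=
  (\matrix_(i, k) [exists j, A i j && B j k])%R.

Definition row_major (d : nat) (A : 'M[bool]_d) : seq nat :=
  [seq (A i j : nat) | i <- enum 'I_d, j <- enum 'I_d].

Definition encode_matrices (d : nat) (A B : 'M[bool]_d) : input :=
  [:: [:: d]; row_major A; row_major B].

(* The product is left in memory array 0, in row-major order. *)
Definition multiplies_in_quadratic_time (P : program) : Prop :=
  exists kappa c : nat, forall (d : nat) (A B : 'M[bool]_d) (w : nat),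
    0 < d ->
    wide_enough kappa (d + 2) w ->
    let inp := encode_matrices A B in
    exists T : nat,
      [/\ halts_at w P inp T,
          T <= c * d ^ 2
        & forall i k : 'I_d,
            memory (config_at w P inp T) 0 (i * d + k) = bool_mulmx A B i k].

(* Main.v *)
Require Import Defs.
From mathcomp Require Import all_boot all_order all_algebra.
From mathcomp Require Import zify.

(** Given Boolean matrices [A] and [B], take three layers of [d] vertices, join
    vertex [i] of the first layer to vertex [j] of the second when [A i j], and
    vertex [j] of the second to vertex [k] of the third when [B j k].  Then [i]
    and [k] are at distance 2 exactly when [(A B) i k].  Symmetric arcs of
    weight 1 serve all four variants of the problem.  Adding [d ^ 2] isolated
    vertices makes the average degree O(1) without increasing the size of the
    graph or the number of reachable pairs beyond O(d ^ 2); an enumeration with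
    linear preprocessing and delay O(1 + average degree) thus ends within
    O(d ^ 2) steps.  The multiplier writes this graph to memory and then runs
    the enumerator, with reads of the input turned into loads from memory and
    outputs turned into stores. *)

Set Implicit Arguments.
Unset Strict Implicit.
Unset Printing Implicit Defensive.

Import Order.TTheory GRing.Theory Num.Theory.

(** * Executions *)

(** The effect of an instruction, separated from its fetching: runs of straight-line code become a
    [foldl], which evaluates by computation. *)
Definition exec (w : nat) (inp : input) (s : config) (i : instr) : config :=
  match i with
  | IConst r c => set_reg s r (c %% 2 ^ w)
  | IBinop o r r1 r2 => set_reg s r (eval_binop w o (regs s r1) (regs s r2))
  | IRead r a i => set_reg s r (nth 0 (nth [::] inp a) (regs s i) %% 2 ^ w)
  | ILoad r a i => set_reg s r (memory s a (regs s i))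
  | IStore a i r => set_mem s a (regs s i) (regs s r)
  | IJz r l =>
      Config (if regs s r == 0 then l else (pc s).+1) (regs s) (memory s)
  | IEmit _ _ _ => Config (pc s).+1 (regs s) (memory s)
  | IHalt => s
  end.

Definition straight (i : instr) : bool :=
  match i with IJz _ _ | IHalt => false | _ => true end.

Definition code_at (Q : program) (k : nat) (c : seq instr) : Prop :=
  forall j, j < size c -> nth IHalt Q (k + j) = nth IHalt c j.

Section Execution.

Variables (w : nat) (Q : program) (inp : input).

Lemma run_straight (c : seq instr) (s : config) :
  code_at Q (pc s) c -> all straight c ->
  iter (size c) (step w Q inp) s = foldl (exec w inp) s c.
Proof.
elim: c s => // i c IH s Qc /andP[si sc].
have Es : step w Q inp s = exec w inp s i.
  by rewrite -[i]/(nth IHalt (i :: c) 0) -Qc // addn0.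
rewrite iterSr Es IH //= => j ltj.
have -> : pc (exec w inp s i) = (pc s).+1 by case: i si {Qc Es}.
by rewrite addSnnS Qc.
Qed.

Lemma pc_straight (c : seq instr) (s : config) :
  all straight c -> pc (foldl (exec w inp) s c) = pc s + size c.
Proof.
elim: c s => [|i c IH] s /=; first by rewrite addn0.
by case/andP=> si sc; rewrite IH // addnS -addSn; case: i si.
Qed.

(** The last instruction may be a jump or a halt, so this covers a loop body with its jump back as
    well as any compiled block. *)
Lemma run_code (c : seq instr) (i : instr) (s : config) :
  code_at Q (pc s) (rcons c i) -> all straight c ->
  iter (size c).+1 (step w Q inp) s = foldl (exec w inp) s (rcons c i).
Proof.
move=> Qc sc; rewrite iterS foldl_rcons run_straight //; last first.
  by move=> j ltj; rewrite Qc ?size_rcons ?nth_rcons ?ltj // ltnW.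
have /= := Qc (size c); rewrite size_rcons nth_rcons ltnn eqxx => /(_ (leqnn _)).
by rewrite -pc_straight // => <-.
Qed.

Lemma halted_iter (s : config) (t : nat) :
  halted Q s -> iter t (step w Q inp) s = s.
Proof.
move=> hs; elim: t => //= t ->.
by move: hs; rewrite /halted /step; case: (fetch Q s).
Qed.

(** A simulation yields some time at which the machine has halted, while [halts_at] asks for the
    first one. Halted configurations are fixed points, so both times show the same memory. *)
Lemma halts_before (T : nat) :
  halted Q (config_at w Q inp T) ->
  exists T', [/\ T' <= T, halts_at w Q inp T' &
                 config_at w Q inp T' = config_at w Q inp T].
Proof.
move=> hT.
have ex : exists t, halted Q (config_at w Q inp t) by exists T.
case: (ex_minnP ex) => T' hT' minT'; exists T'.
have le : T' <= T by exact: minT'.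
split=> //.
  by split=> // t; rewrite ltnNge; apply: contra => /minT'.
by rewrite /config_at -(subnK le) iterD [RHS]halted_iter.
Qed.

(** Outputs are later shifted by subtraction modulo [2 ^ w], which is faithful only on genuine
    words. Memory is included because loads copy it to registers unreduced. *)
Definition bounded (s : config) : Prop :=
  (forall r, regs s r < 2 ^ w) /\ (forall a i, memory s a i < 2 ^ w).

Lemma step_bounded (s : config) : bounded s -> bounded (step w Q inp s).
Proof.
case=> br bm; rewrite /step; case: (fetch Q s) => * //=; split=> //= r';
  do ?[move=> ?]; case: ifP => //; rewrite /eval_binop ?ltn_mod ?expn_gt0 //.
Qed.

Lemma config_at_bounded (t : nat) : bounded (config_at w Q inp t).
Proof.
elim: t => [|t IH]; last exact: step_bounded.
by split=> * /=; rewrite expn_gt0.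
Qed.

End Execution.

(** * Outputs, delay and total time *)

Lemma size_outputs (w : nat) (P : program) (inp : input) (T : nat) :
  size (outputs w P inp T) = size (output_times w P inp T).
Proof. by rewrite size_pmap size_filter. Qed.

Lemma outputsS (w : nat) (P : program) (inp : input) (T : nat) :
  outputs w P inp T.+1 =
    outputs w P inp T ++ oapp (cons^~ [::]) [::] (emission P (config_at w P inp T)).
Proof.
by rewrite /outputs -addn1 iotaD pmap_cat /=; case: emission.
Qed.

(** The gaps telescope from [p] to [T], one per output and a last one before termination. Truncated
    subtraction can only overestimate a gap, so no ordering of [ts] is assumed. *)
Lemma time_delay (p : nat) (ts : seq nat) (T : nat) :
  T <= p + (size ts).+1 * delay p ts T.
Proof.
have gap (s : seq nat) q g :
    all (fun x => x <= g) (pairmap (fun s t => t - s) q s) ->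
    last q s <= q + size s * g.
  elim: s q => [|x s IH] q /=; first by rewrite addn0.
  case/andP=> leg /IH le; rewrite mulSn addnA; apply: leq_trans le _.
  by rewrite leq_add2r -leq_subLR.
have /gap : all (fun x => x <= delay p ts T)
                (pairmap (fun s t => t - s) p (rcons ts T)).
  by apply/allP=> g gin; rewrite /delay (big_rem g) //= leq_maxl.
by rewrite last_rcons size_rcons.
Qed.

(** * Graphs of matrix products *)

Lemma nth_offsets (s : seq nat) (a x : nat) :
  nth 0 (a :: scanl addn a s) x = if x <= size s then a + sumn (take x s) else 0.
Proof.
elim: s a x => [|b s IH] a [|x] //=; rewrite ?addn0 ?nth_nil //.
by rewrite IH ltnS addnA.
Qed.

Lemma big_count_pairs (n : nat) (e : rel 'I_n) :
  \sum_(u < n) #|e u| = #|[set x : 'I_n * 'I_n | e x.1 x.2]|.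
Proof.
rewrite -sum1_card (eq_bigl (fun x => e x.1 x.2)); last by move=> x; rewrite inE.
rewrite -(pair_big_dep xpredT (fun u v => e u v) (fun _ _ => 1)) /=.
by apply: eq_bigr => u _; rewrite sum1_card.
Qed.

(** The matrix as a block of an adjacency matrix, with its corner at row [a] and column [b].
    Coordinates are plain numbers, as the program handles them. *)
Definition placed (d : nat) (M : 'M[bool]_d) (a b u v : nat) : bool :=
  [exists i : 'I_d, exists j : 'I_d, [&& M i j, u == a + i & v == b + j]].

Lemma placedP (d : nat) (M : 'M[bool]_d) (a b u v : nat) :
  reflect (exists i j : 'I_d, [/\ M i j, u = a + i & v = b + j])
          (placed M a b u v).
Proof.
apply: (iffP existsP) => [[i /existsP[j /and3P[? /eqP? /eqP?]]]|[i [j [? -> ->]]]].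
  by exists i, j.
by exists i; apply/existsP; exists j; rewrite !eqxx !andbT.
Qed.

Lemma placed_shift (d : nat) (M : 'M[bool]_d) (s a b u v : nat) :
  placed M (s + a) (s + b) (s + u) (s + v) = placed M a b u v.
Proof.
apply: eq_existsb => i; apply: eq_existsb => j.
by rewrite -!addnA !eqn_add2l.
Qed.

Section LayeredGraph.

Variables (d : nat) (A B : 'M[bool]_d).
Hypothesis d_gt0 : 0 < d.

Definition layered (s u v : nat) : bool :=
  [|| placed A s (s + d) u v, placed A s (s + d) v u,
      placed B (s + d) (s + 2 * d) u v | placed B (s + d) (s + 2 * d) v u].

Lemma layeredP (s u v : nat) : layered s u v ->
  exists i j : 'I_d,
    [\/ [/\ A i j, u = s + i & v = s + d + j],
        [/\ A i j, v = s + i & u = s + d + j],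
        [/\ B i j, u = s + d + i & v = s + 2 * d + j]
      | [/\ B i j, v = s + d + i & u = s + 2 * d + j]].
Proof.
case/or4P=> /placedP[i [j H]]; exists i, j;
  by [constructor 1 | constructor 2 | constructor 3 | constructor 4].
Qed.

Lemma layeredC (s u v : nat) : layered s u v = layered s v u.
Proof.
rewrite /layered orbCA [in LHS]orbA [in LHS](orbC (placed B _ _ u v)).
by rewrite -!orbA orbCA.
Qed.

Lemma layered_bounds (s u v : nat) : layered s u v ->
  (s <= u < s + 3 * d) && (s <= v < s + 3 * d).
Proof.
case/layeredP=> i [j H]; have := ltn_ord i; have := ltn_ord j.
by case: H => -[_ -> ->]; lia.
Qed.

Lemma layered_irr (s u : nat) : layered s u u = false.
Proof.
apply/negP=> /layeredP[i [j H]]; have := ltn_ord i; have := ltn_ord j.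
by case: H => -[_ -> ?]; lia.
Qed.

(* The [d * d] isolated vertices keep the average degree bounded. *)
Definition layered_graph : graph :=
  @Graph (d * d + 3 * d) (fun u v => layered (d * d) u v) (fun _ _ => 1)
         (fun u => [seq v : 'I_(d * d + 3 * d) <- enum 'I_(d * d + 3 * d)
                   | layered (d * d) u v]).

Local Notation G := layered_graph.
Local Notation s := (d * d).
Local Notation N := (3 * d).
Local Notation n := (d * d + 3 * d).

Lemma layered_graph_valid (directed weighted : bool) :
  valid_graph directed weighted G.
Proof.
split=> //=; first by lia.
- by move=> u /=; rewrite layered_irr.
- move=> u; split; first by rewrite filter_uniq ?enum_uniq.
  by move=> v; rewrite mem_filter mem_enum andbT.
- by move=> _; split=> // u v /=; rewrite layeredC.
Qed.

Lemma max_weight_layered : max_weight G <= 1.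
Proof. by do 2 apply/bigmax_leqP=> ? _. Qed.

Lemma walk_weight_layered (u : 'I_n) (p : seq 'I_n) :
  @walk_weight G u p = size p.
Proof. by elim: p u => //= v p IH u; rewrite IH. Qed.

(** Every arc has both ends from [s] on, and a walk between distinct vertices has an arc; reachable
    pairs off the diagonal thus avoid the isolated vertices. *)
Lemma path_layered_ge (u : 'I_n) (p : seq 'I_n) :
  path (@edge G) u p -> u != last u p -> (s <= u) && (s <= last u p).
Proof.
case: p => [|v p] /=; first by rewrite eqxx.
case/andP=> /layered_bounds/andP[/andP[-> _] /andP[lev _]] pp _ /=.
elim: p v lev pp => //= x p IH v lev.
by case/andP=> /layered_bounds/andP[_ /andP[? _]] /IH->.
Qed.

Lemma dist_layered_ge (u v : 'I_n) (k : nat) :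
  @is_dist G u v k -> u != v -> (s <= u) && (s <= v).
Proof. by case=> [[p [pp <- _]]] _; exact: path_layered_ge. Qed.

Lemma dist_uniq (u v : 'I_n) (k k' : nat) :
  @is_dist G u v k -> @is_dist G u v k' -> k = k'.
Proof.
case=> [[p [pp lp <-]]] m [[p' [pp' lp' <-]]] m'.
by apply/eqP; rewrite eqn_leq m // m'.
Qed.

Lemma dist_layered2 (u v : 'I_n) (i k : 'I_d) :
  val u = s + i -> val v = s + 2 * d + k ->
  @is_dist G u v 2 <-> bool_mulmx A B i k.
Proof.
move=> Eu Ev; rewrite mxE; split=> [[[p [pp lp]]]|].
  rewrite walk_weight_layered => szp _.
  case: p szp pp lp => [|x [|y [|? ?]]] //= _ /and3P[E1 E2 _] Ey; subst y.
  (* Each arc has four possible forms; the ranges of the layers exclude all combinations but an arc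
     of [A] followed by an arc of [B], both taken forwards. *)
  case: (layeredP E1) => j1 [j2 H1]; case: (layeredP E2) => j3 [j4 H2].
  have := (ltn_ord i, ltn_ord k, ltn_ord j1, ltn_ord j2, ltn_ord j3, ltn_ord j4).
  rewrite Eu in H1; rewrite Ev in H2.
  case=> [[[[[? ?] ?] ?] ?] ?].
  case: H1 => -[A1 e1 e2]; case: H2 => -[A2 e3 e4]; try by exfalso; lia.
  have ei : i = j1 by apply: val_inj => /=; lia.
  have ej : j2 = j3 by apply: val_inj => /=; lia.
  have ek : k = j4 by apply: val_inj => /=; lia.
  by apply/existsP; exists j2; rewrite ei A1 ej ek A2.
case/existsP=> j /andP[Aij Bjk]; split.
  have ltx : s + d + j < n by have := ltn_ord j; lia.
  exists [:: Ordinal ltx; v]; split=> //=; rewrite andbT; apply/andP; split.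
    by apply/or4P; constructor 1; apply/placedP; exists i, j.
  by apply/or4P; constructor 3; apply/placedP; exists j, k.
(* No shorter walk exists: the first and third layers are disjoint and no arc joins them. *)
move=> p; rewrite walk_weight_layered.
have := (ltn_ord i, ltn_ord k) => [[? ?]].
case: p => [_ /= uv|x [|? ?]] //=; first by exfalso; move: Ev; rewrite -uv Eu; lia.
rewrite andbT => /layeredP[j1 [j2]] H xv; subst x.
have := (ltn_ord j1, ltn_ord j2) => [[? ?]]; rewrite Eu Ev in H.
by case: H => -[_ ? ?]; exfalso; lia.
Qed.

(** Pairs of layer vertices are scanned in row-major order, candidate [e'] having tail [s + e' %/ N]
    and head [s + e' %% N]. The heads retained form a prefix of the concatenated adjacency lists. *)
Definition arcs (e : nat) : seq nat :=
  [seq s + e' %% N | e' <- iota 0 e & layered s (s + e' %/ N) (s + e' %% N)].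

Lemma arcsS (e : nat) :
  arcs e.+1 = arcs e ++
    (if layered s (s + e %/ N) (s + e %% N) then [:: s + e %% N] else [::]).
Proof.
by rewrite /arcs -[e.+1]addn1 iotaD filter_cat map_cat /=; case: ifP.
Qed.

Lemma size_arcs (e : nat) : size (arcs e) <= e.
Proof.
by rewrite size_map size_filter (leq_trans (count_size _ _)) ?size_iota.
Qed.

Lemma arcs_lt (e x : nat) : x \in arcs e -> x < n.
Proof. by case/mapP=> y _ ->; rewrite ltn_add2l ltn_mod; lia. Qed.

Lemma flatten_isolated (x : nat) : x <= s ->
  flatten [seq [seq v <- iota 0 n | layered s u v] | u <- iota 0 x] = [::].
Proof.
move=> lex; apply: size0nil; rewrite size_flatten /shape sumnE.
rewrite big_map big_map big_seq big1 // => u; rewrite mem_iota add0n => /= ltu.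
rewrite size_filter; apply/eqP; rewrite -leqn0 leqNgt -has_count.
by apply/hasPn=> v _; apply/negP=> /layered_bounds; lia.
Qed.

(** The first [s] rows are empty, and a later row has no arc in the columns below [s], so it amounts
    to [N] consecutive candidates. *)
Lemma flatten_rows (m : nat) :
  flatten [seq [seq v <- iota 0 n | layered s u v] | u <- iota 0 (s + m)]
    = arcs (m * N).
Proof.
elim: m => [|m IH].
  by rewrite addn0 flatten_isolated.
have -> : s + m.+1 = s + m + 1 by lia.
rewrite [iota 0 (s + m + 1)]iotaD map_cat flatten_cat IH /= cats0 /arcs.
have -> : m.+1 * N = m * N + N by rewrite mulSn addnC.
rewrite [iota 0 (m * N + N)]iotaD filter_cat map_cat; congr (_ ++ _).
rewrite [iota 0 n]iotaD filter_cat.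
have -> : [seq v <- iota 0 s | layered s (s + m) v] = [::].
  apply: size0nil; rewrite size_filter; apply/eqP; rewrite -leqn0 leqNgt -has_count.
  apply/hasPn=> v; rewrite mem_iota => /= ltv.
  by apply/negP=> /layered_bounds; lia.
rewrite cat0s !add0n -[s in iota s]addn0 iotaDl -[m * N]addn0 iotaDl.
rewrite !filter_map -map_comp.
have Ex (x : nat) : x \in iota 0 N ->
    ((m * N + x) %/ N = m) * ((m * N + x) %% N = x).
  rewrite mem_iota => /= ltx; have N0 : 0 < N by lia.
  by rewrite divnMDl // modnMDl divn_small ?modn_small ?addn0.
rewrite (@eq_in_filter _ (preim (addn (m * N)) _)
                         (preim (addn s) (layered s (s + m)))).
  by apply/eq_in_map=> x; rewrite mem_filter /= => /andP[_ /Ex ->].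
by move=> x /Ex /= xE; rewrite !xE.
Qed.

Lemma adj_rows :
  [seq [seq val v | v <- @adj G u] | u <- enum 'I_n]
    = [seq [seq v <- iota 0 n | layered s u v] | u <- iota 0 n].
Proof.
rewrite -[in RHS]val_enum_ord -map_comp; apply: eq_map => u /=.
by rewrite /= filter_map.
Qed.

Lemma flatten_adj :
  flatten [seq [seq val v | v <- @adj G u] | u <- enum 'I_n] = arcs (N * N).
Proof. by rewrite adj_rows flatten_rows. Qed.

Lemma sum_degree_layered : \sum_(u < n) #|@edge G u| = size (arcs (N * N)).
Proof.
rewrite -flatten_adj size_flatten /shape sumnE !big_map.
rewrite -enumT [RHS]big_enum /=; apply: eq_bigr => u _; rewrite size_map.
have [_ _ /(_ u)[uniq_adj adjE] _ _] := layered_graph_valid true true.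
by rewrite -(eq_card adjE); apply/card_uniqP.
Qed.

Lemma num_edges_layered (directed : bool) : num_edges directed G <= N * N.
Proof.
apply: leq_trans (size_arcs _); rewrite -sum_degree_layered big_count_pairs.
by apply: subset_leq_card; apply/subsetP=> x; rewrite !inE => /andP[].
Qed.

(* Array [2 * a + 1] represents the array [a] of the input, of which the first
   [e] candidate arcs have been processed. *)
Definition graph_mem (weighted : bool) (e a x : nat) : nat :=
  match a with
  | 1 => (x == 0) * n
  | 3 => if (x - s).-1 * N < e then size (arcs (minn e ((x - s) * N))) else 0
  | 5 => nth 0 (arcs e) x
  | 7 => weighted && (x < size (arcs e))
  | _ => 0
  end.

(** Cell [s + u.+1] ends up with the number of arcs in the rows up to [u], a prefix sum of degrees.
    Truncated subtraction gives 0 up to cell [s], as isolated vertices require; past cell [n] both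
    sides take the default 0. *)
Lemma graph_mem_start (weighted : bool) (x : nat) :
  graph_mem weighted (N * N) 3 x =
  nth 0 (0 :: scanl addn 0 [seq size (@adj G u) | u <- enum 'I_n]) x.
Proof.
rewrite nth_offsets size_map size_enum_ord add0n /=.
have N0 : 0 < N by lia.
rewrite ltn_pmul2r //.
have -> : ((x - s).-1 < N) = (x <= n) by lia.
case: leqP => // lex.
have -> : minn (N * N) ((x - s) * N) = (x - s) * N.
  by apply/minn_idPr; rewrite leq_mul2r; apply/orP; right; lia.
have -> : [seq size (@adj G u) | u <- enum 'I_n] =
          shape [seq [seq v <- iota 0 n | layered s u v] | u <- iota 0 n].
  by rewrite -adj_rows /shape -map_comp; apply: eq_map => u /=; rewrite size_map.
rewrite /shape -map_take -size_flatten -map_take take_iota (minn_idPl lex).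
case: (leqP s x) => [le|lt]; first by rewrite -{2}(subnKC le) flatten_rows.
have -> : x - s = 0 by lia.
by rewrite mul0n flatten_isolated ?(ltnW lt).
Qed.

Lemma graph_memE (weighted : bool) (a x : nat) :
  graph_mem weighted (N * N) a.*2.+1 x = nth 0 (nth [::] (encode_graph weighted G) a) x.
Proof.
case: a => [|[|[|a]]].
- by case: x => [|x] /=; rewrite ?mul1n ?nth_nil.
- exact: graph_mem_start.
- by rewrite -[RHS]/(nth 0 (flatten _) x) flatten_adj.
rewrite /encode_graph nth_cat /=; case: weighted => /=; last first.
  by case: a => [|a] /=; rewrite !nth_nil.
case: a => [|a] /=; last by rewrite !nth_nil.
(* All weights are 1, so the weight array has a 1 for each arc. *)
have -> : flatten [seq [seq 1 | v <- @adj G u] | u <- enum 'I_n] =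
          nseq (size (arcs (N * N))) 1.
  rewrite -flatten_adj; elim: (enum _) => //= u l IH.
  rewrite IH size_cat nseqD size_map; congr (_ ++ _).
  by elim: [seq _ <- _ | _] => //= ? ? ->.
by rewrite nth_nseq; case: ltnP.
Qed.

(** [IRead] reduces modulo [2 ^ w] and [ILoad] does not; on wide enough words this bound makes them
    agree. *)
Lemma graph_mem_lt (weighted : bool) (e a x : nat) :
  e <= N * N -> graph_mem weighted e a x < n + N * N + 1.
Proof.
move=> lee; case: a => [|[|[|[|[|[|[|[|a]]]]]]]] /=; try lia.
- case: ifP => _; last by lia.
  by have := leq_trans (size_arcs _) (geq_minl e ((x - s) * N)); lia.
- case: (ltnP x (size (arcs e))) => lx; last by rewrite nth_default; lia.
  by apply: leq_trans (arcs_lt (mem_nth 0 lx)) _; lia.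
Qed.

End LayeredGraph.

(** * Writing the graph to memory *)

Lemma nth_row_major (d : nat) (M : 'M[bool]_d) (i j : 'I_d) :
  nth 0 (row_major M) (i * d + j) = M i j.
Proof.
have nth_rows (T T' : Type) (z : T) (z' : T') (f : T -> T' -> nat) s t x y :
    x < size s -> y < size t ->
    nth 0 [seq f u v | u <- s, v <- t] (x * size t + y) = f (nth z s x) (nth z' t y).
  move=> ltx lty; elim: s x ltx => //= u s IH [|x] ltx.
    by rewrite nth_cat size_map lty (nth_map z').
  rewrite nth_cat size_map mulSn -addnA ltnNge leq_addr /= addKn.
  exact: IH.
have := @nth_rows _ _ i j (fun u v => M u v : nat) (enum 'I_d) (enum 'I_d) i j.
by rewrite !size_enum_ord !nth_ord_enum => ->.
Qed.

Definition target (i : instr) : option nat :=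
  match i with
  | IConst r _ | IBinop _ r _ _ | IRead r _ _ | ILoad r _ _ => Some r
  | _ => None
  end.

Definition stores (i : instr) : bool := if i is IStore _ _ _ then true else false.

Lemma regs_frame (w : nat) (inp : input) (c : seq instr) (t : config) (r : nat) :
  r \notin pmap target c -> regs (foldl (exec w inp) t c) r = regs t r.
Proof.
have step1 i s : Some r != target i -> regs (exec w inp s i) r = regs s r.
  by case: i => //= *; rewrite ifN.
elim: c t => //= i c IH t; case Ei: (target i) => [r'|] /=; last first.
  by move/IH->; apply: step1; rewrite Ei.
by rewrite inE negb_or => /andP[ne /IH->]; apply: step1; rewrite Ei.
Qed.

Lemma memory_frame (w : nat) (inp : input) (c : seq instr) (t : config) :
  ~~ has stores c -> memory (foldl (exec w inp) t c) = memory t.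
Proof.
elim: c t => //= i c IH t; rewrite negb_or => /andP[si /IH->].
by case: i si.
Qed.

(** For [x < a] the difference wraps around to at least [W - a], hence to at least [d], beyond every
    index [j]. *)
Lemma modn_sub_eq (W x a j d : nat) : x < W -> a + d <= W -> j < d ->
  ((x + (W - a)) %% W == j) = (x == a + j).
Proof.
move=> ltx lea ltj; case: (leqP a x) => [le|lt].
  have -> : x + (W - a) = x - a + W by lia.
  by rewrite modnDr modn_small; lia.
by rewrite modn_small; lia.
Qed.

Lemma placed_modn (d : nat) (M : 'M[bool]_d) (W a b u v : nat) :
  u < W -> v < W -> a + d <= W -> b + d <= W ->
  placed M 0 0 ((u + (W - a)) %% W) ((v + (W - b)) %% W) = placed M a b u v.
Proof.
move=> ltu ltv lea leb; apply: eq_existsb => i; apply: eq_existsb => j.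
by rewrite !add0n (modn_sub_eq ltu lea) ?(modn_sub_eq ltv leb).
Qed.

Local Arguments eval_binop : simpl never.
Local Arguments modn : simpl never.
Local Arguments expn : simpl never.

(* Registers: 1 to 6 hold the constants 1, 2, d, d^2, 3d, (3d)^2, and 19, 20
   hold d^2 + 2d, 2d; 7 is the loop counter, 8 the number of arcs found and 9
   tells whether the graph is weighted; 10 to 18 are scratch. *)

(* Sets the flag in register 16 if the entry of array [m] at the coordinates in
   registers [p] and [q] is 1; the comparisons mask coordinates out of range,
   among them those that a subtraction has wrapped around. *)
Definition read_block (m p q : nat) : seq instr :=
  [:: IBinop OpMul 17 p 3; IBinop OpAdd 17 17 q; IRead 17 m 17;
      IBinop OpLt 18 p 3; IBinop OpMul 17 17 18;
      IBinop OpLt 18 q 3; IBinop OpMul 17 17 18; IBinop OpOr 16 16 17].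

Definition prologue (weighted : bool) : seq instr :=
  [:: IConst 1 1; IConst 2 2; IRead 3 0 0; IBinop OpMul 4 3 3;
      IBinop OpAdd 20 3 3; IBinop OpAdd 5 20 3; IBinop OpMul 6 5 5;
      IBinop OpAdd 19 4 20; IBinop OpAdd 17 4 5; IStore 1 0 17;
      IConst 9 weighted].

Definition arc_coordinates : seq instr :=
  [:: IBinop OpDiv 10 7 5; IBinop OpMul 17 10 5; IBinop OpSub 11 7 17;
      IBinop OpSub 12 10 3; IBinop OpSub 13 11 3;
      IBinop OpSub 14 10 20; IBinop OpSub 15 11 20; IConst 16 0].

Definition arc_test : seq instr :=
  read_block 1 10 13 ++ read_block 1 11 12 ++
  read_block 2 12 15 ++ read_block 2 13 14.

Definition arc_record : seq instr :=
  [:: IBinop OpAdd 17 11 4; IBinop OpMul 17 17 16; IStore 5 8 17;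
      IBinop OpMul 17 16 9; IStore 7 8 17; IBinop OpAdd 8 8 16;
      IBinop OpAdd 17 10 4; IBinop OpAdd 17 17 1; IStore 3 17 8;
      IBinop OpAdd 7 7 1; IBinop OpEq 17 7 6].

Definition loop_body : seq instr := arc_coordinates ++ arc_test ++ arc_record.

Definition setup (weighted : bool) : seq instr :=
  prologue weighted ++ rcons loop_body (IJz 17 (size (prologue weighted))).

Section Setup.

Variables (d w : nat) (A B : 'M[bool]_d) (weighted : bool).
Hypothesis d_gt0 : 0 < d.

Local Notation s := (d * d).
Local Notation N := (3 * d).
Local Notation n := (d * d + 3 * d).
Local Notation W := (2 ^ w).

Hypothesis w_wide : n + N * N + 3 <= W.

Local Notation inp := (encode_matrices A B).

(** With a coordinate out of range the read may return anything, even from an overflowed address,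
    but a comparison multiplies it by 0. Listing the four uses makes the registers concrete, so that
    the block evaluates. *)
Lemma read_block_spec (M : 'M[bool]_d) (m p q : nat) (b : bool) (t : config) :
  nth [::] inp m = row_major M ->
  (m, p, q) \in [:: (1, 10, 13); (1, 11, 12); (2, 12, 15); (2, 13, 14)] ->
  regs t 3 = d -> regs t 16 = b ->
  exists t', [/\ foldl (exec w inp) t (read_block m p q) = t',
      regs t' 16 = b || placed M 0 0 (regs t p) (regs t q),
      forall r, ~~ (16 <= r <= 18) -> regs t' r = regs t r
    & memory t' = memory t].
Proof.
move=> inpM mpq Ed Eb; exists (foldl (exec w inp) t (read_block m p q)).
split; last exact: memory_frame; first by [].
  rewrite (_ : regs _ _ =
    eval_binop w OpOr (regs t 16)
      (eval_binop w OpMul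
        (eval_binop w OpMul
          (nth 0 (nth [::] inp m)
             (eval_binop w OpAdd (eval_binop w OpMul (regs t p) (regs t 3))
                (regs t q)) %% W)
          (eval_binop w OpLt (regs t p) (regs t 3)))
        (eval_binop w OpLt (regs t q) (regs t 3)))); last first.
    by move: mpq; rewrite !inE => /or4P[] /eqP[-> -> ->].
  rewrite Ed Eb inpM /eval_binop.
move: (regs t p) (regs t q) => x y.
have small (c : bool) : c %% W = c by apply: modn_small; case: c; lia.
rewrite !small.
case: (ltnP x d) => ltx; last first.
  rewrite muln0 mod0n mul0n mod0n.
  case: placedP => [[i [j [_ Ex _]]]|_]; last first.
    by case: b {Eb} => /=; rewrite ?mod0n // (small true).
  by have := ltn_ord i; lia.
case: (ltnP y d) => lty; last first.
  rewrite muln0 mod0n.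
  case: placedP => [[i [j [_ _ Ey]]]|_]; last first.
    by case: b {Eb} => /=; rewrite ?mod0n // (small true).
  by have := ltn_ord j; lia.
have -> : (x * d) %% W = x * d.
  by rewrite modn_small // (leq_trans _ w_wide) //; nia.
have -> : (x * d + y) %% W = x * d + y.
  by rewrite modn_small // (leq_trans _ w_wide) //; nia.
rewrite (nth_row_major M (Ordinal ltx) (Ordinal lty)) !small !muln1 !small.
have -> : placed M 0 0 x y = M (Ordinal ltx) (Ordinal lty).
  apply/placedP/idP => [[i [j [Mij Ex Ey]]]|Mxy].
    have -> : Ordinal ltx = i by apply: val_inj.
    by have -> : Ordinal lty = j by apply: val_inj.
  by exists (Ordinal ltx), (Ordinal lty).
  by case: b (M _ _) {Eb} => -[] /=; rewrite ?mod0n ?(small true).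
by move=> r Hr; apply: regs_frame; rewrite /= !inE; lia.
Qed.

Definition loop_regs (e r : nat) : nat :=
  match r with
  | 1 => 1 | 2 => 2 | 3 => d | 4 => s | 5 => N | 6 => N * N | 7 => e
  | 8 => size (arcs A B e) | 9 => weighted | 19 => s + 2 * d | 20 => 2 * d
  | _ => 0
  end.

Definition loop_inv (e : nat) (t : config) : Prop :=
  (forall r, ~~ (10 <= r <= 18) -> regs t r = loop_regs e r) /\
  (forall a x, memory t a x = graph_mem A B weighted e a x).

Lemma prologue_spec :
  loop_inv 0 (foldl (exec w inp) init_config (prologue weighted)).
Proof.
have small x : x <= n + N * N -> x %% W = x by move=> le; rewrite modn_small; lia.
split=> [r Hr|a x].
  case: (ltnP r 21) => ltr; last first.
    rewrite regs_frame //; last by rewrite /= !inE; lia.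
    by clear Hr; do 21 (case: r ltr => [//|r] ltr).
  do 21 (case: r Hr ltr => [|r] Hr ltr;
         first by rewrite /= /eval_binop ?small //=; lia).
  by [].
rewrite /= /eval_binop !small; try lia.
case: a => [|[|a]] /=; rewrite ?andbF //.
  by case: eqP => _; rewrite ?mul1n; lia.
by case: a => [|[|[|[|[|[|a]]]]]] //=; rewrite ?nth_nil ?andbF.
Qed.

Lemma arc_coordinates_spec (e : nat) (t : config) : e < N * N -> loop_inv e t ->
  let t' := foldl (exec w inp) t arc_coordinates in
  let u := e %/ N in let v := e %% N in
  [/\ [/\ regs t' 10 = u, regs t' 11 = v & regs t' 16 = 0],
      [/\ regs t' 12 = (u + (W - d)) %% W, regs t' 13 = (v + (W - d)) %% W,
          regs t' 14 = (u + (W - 2 * d)) %% W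
        & regs t' 15 = (v + (W - 2 * d)) %% W]
    & loop_inv e t'].
Proof.
move=> lte [Hr Hm].
have N0 : 0 < N by lia.
have E10 : regs (foldl (exec w inp) t arc_coordinates) 10 = e %/ N.
  rewrite /= /eval_binop !Hr //= modn_small //.
  by rewrite (leq_ltn_trans (leq_div _ _)) //; lia.
have E11 : regs (foldl (exec w inp) t arc_coordinates) 11 = e %% N.
  have E : e %/ N * N + e %% N = e by rewrite -divn_eq.
  rewrite /= /eval_binop !Hr //= [(e %/ N) %% W]modn_small; last by nia.
  rewrite [(e %/ N * N) %% W]modn_small; last by lia.
  (* There is no remainder instruction: [e %% N] is computed by subtraction, whose extra [W]
     vanishes modulo [W]. *)
  rewrite (_ : e + (W - e %/ N * N) = e %% N + W); last by lia.
  by rewrite modnDr modn_small //; lia.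
split.
- by split=> //; rewrite /= mod0n.
- rewrite -{1 2}E10 -{1 2}E11.
  by split; rewrite /= /eval_binop !Hr.
- split=> [r nr|a x]; last by rewrite memory_frame.
  by rewrite regs_frame ?Hr //= !inE; lia.
Qed.

(** The four reads are the four disjuncts of [layered]: [A] at [(u, v - d)] and [(v, u - d)], [B] at
    [(u - d, v - 2 * d)] and [(v - d, u - 2 * d)], where [u] and [v] are counted from [s]. *)
Lemma arc_test_spec (e : nat) (t : config) : e < N * N -> loop_inv e t ->
  let t' := foldl (exec w inp) t (arc_coordinates ++ arc_test) in
  [/\ regs t' 10 = e %/ N, regs t' 11 = e %% N,
      regs t' 16 = layered A B s (s + e %/ N) (s + e %% N) & loop_inv e t'].
Proof.
move=> lte inv; have N0 : 0 < N by lia.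
have lu : e %/ N < W by rewrite (leq_ltn_trans (leq_div _ _)) //; lia.
have lv : e %% N < W by have := ltn_pmod e N0; lia.
have [] := arc_coordinates_spec lte inv.
rewrite /arc_test !foldl_cat; move: (foldl _ t _) => t0.
case=> E10 E11 E16 [E12 E13 E14 E15] [Hr Hm].
have Ed : regs t0 3 = d by rewrite Hr.
have [t1 [-> V1 R1 M1]] := @read_block_spec A 1 10 13 false t0 erefl isT Ed E16.
have [t2 [-> V2 R2 M2]] :=
  @read_block_spec A 1 11 12 _ t1 erefl isT (etrans (R1 3 isT) Ed) V1.
have Ed2 : regs t2 3 = d by rewrite R2 // R1.
have [t3 [-> V3 R3 M3]] := @read_block_spec B 2 12 15 _ t2 erefl isT Ed2 V2.
have Ed3 : regs t3 3 = d by rewrite R3.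
have [t4 [-> V4 R4 M4]] := @read_block_spec B 2 13 14 _ t3 erefl isT Ed3 V3.
have R r : ~~ (16 <= r <= 18) -> regs t4 r = regs t0 r.
  by move=> nr; rewrite R4 // R3 // R2 // R1.
split; [by rewrite R|by rewrite R| |]; last first.
  split=> [r nr|a x]; first by rewrite R ?Hr //; clear - nr; lia.
  by rewrite M4 M3 M2 M1.
rewrite V4; congr (nat_of_bool _).
rewrite R3 // R3 // R2 // R2 // R2 // R2 // !R1 // E10 E11 E12 E13 E14 E15.
have pm M a b u v : a <= 2 * d -> b <= 2 * d -> u < W -> v < W ->
  @placed d M 0 0 ((u + (W - a)) %% W) ((v + (W - b)) %% W) = placed M a b u v.
  by move=> la lb *; apply: placed_modn => //; clear -w_wide la lb; lia.
have p0 M b u v : b <= 2 * d -> u < W -> v < W ->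
  @placed d M 0 0 u ((v + (W - b)) %% W) = placed M 0 b u v.
  by move=> lb lu' lv'; rewrite -(pm M 0 b u v) // subn0 modnDr (modn_small lu').
rewrite !(pm, p0) // ?leq_pmull //.
have pA u v : placed A s (s + d) (s + u) (s + v) = placed A 0 d u v.
  by rewrite -{1}[s]addn0 placed_shift.
by rewrite /layered !pA !placed_shift !orbA.
Qed.

Lemma loop_body_spec (e : nat) (t : config) : e < N * N -> loop_inv e t ->
  let t' := foldl (exec w inp) t loop_body in
  loop_inv e.+1 t' /\ regs t' 17 = (e.+1 == N * N).
Proof.
move=> lte inv; have N0 : 0 < N by lia.
have ltu : e %/ N < N by rewrite ltn_divLR.
have ltv := ltn_pmod e N0.
rewrite /loop_body catA foldl_cat; have [] := arc_test_spec lte inv.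
move: (foldl _ t (_ ++ _)) => {inv} {}t.
set u := e %/ N in ltu *; set v := e %% N in ltv *.
move Db: (layered A B s (s + u) (s + v)) => b Eu Ev Eb [Hr Hm].
have small x : x <= n + N * N -> x %% W = x.
  by move=> le; rewrite modn_small; clear -le w_wide; lia.
have le1 : size (arcs A B e) < n + N * N.
  by have := size_arcs A B e; clear - lte d_gt0; lia.
have E17 x : (b * x <= x) by clear; case: b; rewrite ?mul1n ?mul0n.
have V5 : regs (foldl (exec w inp) t (take 2 arc_record)) 17 = (s + v) * b.
  rewrite /= /eval_binop Ev Eb Hr //= addnC !small //;
    by rewrite ?[_ * b]mulnC ?(leq_trans (E17 _)) //; clear -ltv; lia.
have V7 : regs (foldl (exec w inp) t (take 4 arc_record)) 17 = b * weighted.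
  rewrite /= /eval_binop Eb Hr //= small //.
  by rewrite (leq_trans (E17 _)) //; case: weighted; lia.
have V8 : regs (foldl (exec w inp) t arc_record) 8 = size (arcs A B e.+1).
  rewrite /= /eval_binop Eb Hr //= arcsS size_cat -/u -/v Db small.
    by case: (b).
  by case: (b); rewrite ?addn1 ?addn0 // ltnW.
have V3 : regs (foldl (exec w inp) t (take 8 arc_record)) 17 = s + u.+1.
  by rewrite /= /eval_binop Eu !Hr //= !small; lia.
have Vm a x : memory (foldl (exec w inp) t arc_record) a x =
  if (a == 3) && (x == s + u.+1) then size (arcs A B e.+1) else
  if (a == 7) && (x == size (arcs A B e)) then b * weighted else
  if (a == 5) && (x == size (arcs A B e)) then (s + v) * b else
  graph_mem A B weighted e a x.
  rewrite -V3 -V5 -V7 -V8 -Hm -[size _](Hr 8) //.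
split; last first.
  rewrite /= /eval_binop !Hr //= !small ?addn1 //;
    by [clear -lte; lia | case: (_ == _); clear -lte; lia].
split=> [r nr|a x].
  case: (altP (r =P 7)) => [->|n7].
    by rewrite /= /eval_binop !Hr //= small; lia.
  case: (altP (r =P 8)) => [->|n8]; first exact: V8.
  rewrite regs_frame; last by rewrite /= !inE; lia.
  rewrite Hr //; do 9 (case: r nr n7 n8 => [|r] nr n7 n8 //).
rewrite Vm; move: lte ltu ltv Db N0 (divn_eq e N); rewrite -/u -/v; clear.
move=> lte ltu ltv Db N0 Ee.
have En : arcs A B e.+1 = arcs A B e ++ (if b then [:: s + v] else [::]).
  by rewrite arcsS -/u -/v Db.
case: a => [|[|[|[|[|[|[|[|a]]]]]]]] //=.
- case: eqP => [->|nx].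
    rewrite (_ : s + u.+1 - s = u.+1); last by lia.
    rewrite (_ : (u.+1.-1 * N < e.+1) = true); last by rewrite /=; lia.
    by congr (size (arcs _ _ _)); lia.
  (* The other row boundaries do not change: an earlier row is complete, so both minima are [y * N];
     a later row has not begun, so both tests fail. *)
  set y := x - s; have ny : y <> u.+1 by rewrite /y => ?; apply: nx; lia.
  case: (ltngtP y u.+1) => // lty.
    have le1 : y * N <= u * N by rewrite leq_mul2r; apply/orP; right; lia.
    have -> : minn e.+1 (y * N) = y * N by lia.
    have -> : minn e (y * N) = y * N by lia.
    case: y lty le1 {nx ny} => [|y] lty le1 /=.
      by rewrite !mul0n; case: (0 < e).
    by rewrite !ifT //; move: le1; rewrite mulSn; lia.
  have le1 : u.+1 * N <= y.-1 * N by rewrite leq_mul2r; apply/orP; right; lia.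
  by rewrite !ifF //; move: le1; rewrite mulSn; lia.
- rewrite En nth_cat; case: ltngtP => // ltx.
    by rewrite nth_default 1?ltnW //; case: (b) => //=;
      rewrite nth_default //= subn_gt0.
  by rewrite ltx subnn; case: (b); rewrite ?muln1 ?muln0.
- rewrite En size_cat; case: ltngtP => // ltx.
  + by rewrite (leq_trans ltx (leq_addr _ _)).
  + by rewrite andbF; case: (b); case: weighted => //=; lia.
  by rewrite ltx; case: (b); case: weighted => //=; lia.
Qed.

Lemma code_at_subseq (Q c1 c c2 : seq instr) :
  code_at Q 0 (c1 ++ c ++ c2) -> code_at Q (size c1) c.
Proof.
move=> Qc j ltj; have := Qc (size c1 + j); rewrite add0n => ->.
  by rewrite nth_cat ltnNge leq_addr addKn /= nth_cat ltj.
by rewrite !size_cat ltn_add2l ltn_addr.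
Qed.

(** All iterations take equally many steps. The jump goes back while register 17, which tells
    whether the candidates are exhausted, is 0; control then falls through to the end of [setup]. *)
Lemma setup_spec (Q : program) : code_at Q 0 (setup weighted) ->
  let t := config_at w Q inp (size (prologue weighted) +
                              (size loop_body).+1 * (N * N)) in
  pc t = size (setup weighted) /\ loop_inv (N * N) t.
Proof.
move=> Qc; rewrite /config_at addnC iterD run_straight //; last first.
  by move=> j ltj; rewrite Qc ?nth_cat ?ltj // size_cat ltn_addr.
have Qb : code_at Q (size (prologue weighted))
                    (rcons loop_body (IJz 17 (size (prologue weighted)))).
  by apply: (@code_at_subseq _ _ _ [::]); rewrite cats0.
set t0 := foldl _ _ _.
have pc0 : pc t0 = size (prologue weighted) by rewrite pc_straight.
have inv0 : loop_inv 0 t0 by exact: prologue_spec.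
have NN : 0 < N * N by rewrite muln_gt0; lia.
have loop k : k <= N * N ->
    loop_inv k (iter ((size loop_body).+1 * k) (step w Q inp) t0) /\
    pc (iter ((size loop_body).+1 * k) (step w Q inp) t0) =
      if k == N * N then size (setup weighted) else size (prologue weighted).
  elim: k => [|k IH] lek; first by rewrite muln0 ltn_eqF.
  have [invk pck] := IH (ltnW lek).
  rewrite mulnS iterD; move: (iter _ _ t0) invk pck => t invk pck.
  have Qt : code_at Q (pc t) (rcons loop_body (IJz 17 (size (prologue weighted)))).
    by rewrite pck ltn_eqF.
  rewrite (@run_code w Q inp _ _ t Qt isT) foldl_rcons.
  have := loop_body_spec lek invk.
  have := pc_straight w inp t (isT : all straight loop_body).
  move: (foldl (exec w inp) t loop_body) => t1 pc1 [inv1 E17].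
  split; first by case: inv1.
  by rewrite /= E17 pc1 pck (ltn_eqF lek); case: (k.+1 == _).
by have [inv pcE] := loop _ (leqnn _); rewrite pcE eqxx.
Qed.

End Setup.

(** * Running the enumerator *)

Local Arguments setup : simpl never.

(** The filler writes to scratch register 17; the simulated registers start at 24 and never see
    it. *)
Definition pad (i : instr) : seq instr := rcons (nseq 12 (IConst 17 0)) i.

(* Every instruction becomes a block of 13 instructions, so that addresses are
   translated affinely.  An output [(x, y, 2)] sets the cell of the product
   given by [x] and [y]; any other output writes to the junk cell [2 ^ w - 1]. *)
Definition compile (base : nat) (i : instr) : seq instr :=
  match i with
  | IConst r c => pad (IConst (24 + r) c)
  | IBinop o r r1 r2 => pad (IBinop o (24 + r) (24 + r1) (24 + r2))
  | IRead r a i => pad (ILoad (24 + r) a.*2.+1 (24 + i))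
  | ILoad r a i => pad (ILoad (24 + r) a.*2.+2 (24 + i))
  | IStore a i r => pad (IStore a.*2.+2 (24 + i) (24 + r))
  | IJz r l => pad (IJz (24 + r) (base + 13 * l))
  | IEmit r1 r2 r3 =>
      [:: IBinop OpSub 10 (24 + r1) 4; IBinop OpSub 11 (24 + r2) 19;
          IBinop OpEq 12 (24 + r3) 2;
          IBinop OpLt 13 10 3; IBinop OpMul 12 12 13;
          IBinop OpLt 13 11 3; IBinop OpMul 12 12 13;
          IBinop OpMul 10 10 3; IBinop OpAdd 10 10 11; IBinop OpAdd 10 10 1;
          IBinop OpMul 10 10 12; IBinop OpSub 10 10 1; IStore 0 10 1]
  | IHalt => pad IHalt
  end.

Lemma size_compile (base : nat) (i : instr) : size (compile base i) = 13.
Proof. by case: i. Qed.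

Definition multiplier (weighted : bool) (P : program) : program :=
  setup weighted ++ flatten (map (compile (size (setup weighted))) P).

Section Simulation.

Variables (d w : nat) (A B : 'M[bool]_d) (weighted : bool) (P : program).
Hypothesis d_gt0 : 0 < d.

Local Notation s := (d * d).
Local Notation N := (3 * d).
Local Notation n := (d * d + 3 * d).
Local Notation W := (2 ^ w).

Hypothesis w_wide : n + N * N + 3 <= W.

Local Notation inp := (encode_matrices A B).
Local Notation ginp := (encode_graph weighted (layered_graph A B)).
Local Notation Q := (multiplier weighted P).
Local Notation base := (size (setup weighted)).

Lemma code_at_setup : code_at Q 0 (setup weighted).
Proof. by move=> j ltj; rewrite nth_cat ltj. Qed.

Lemma code_at_compile (k : nat) : k < size P ->
  code_at Q (base + 13 * k) (compile base (nth IHalt P k)).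
Proof.
move=> ltk j; rewrite size_compile => ltj.
have nth_after (c c' : program) x : nth IHalt (c ++ c') (size c + x) = nth IHalt c' x.
  by rewrite nth_cat ifN ?addKn // -leqNgt leq_addr.
rewrite -addnA nth_after; move: base => b; elim: P k ltk => [//|i P' IH [|k] ltk].
  by rewrite muln0 nth_cat size_compile ltj.
by rewrite mulnS -addnA -{1}(size_compile b i) nth_after IH.
Qed.

(** An address outside [P] reads as [IHalt] by default; its translation falls outside the multiplier
    and halts likewise. *)
Lemma multiplier_end (k : nat) : size P <= k -> nth IHalt Q (base + 13 * k) = IHalt.
Proof.
move=> lek; rewrite nth_default // size_cat leq_add2l.
move: base => b; apply: leq_trans (_ : 13 * size P <= _); last by rewrite leq_mul.
elim: P {lek} => // i P' IH.
by rewrite mulnS [flatten _]/(_ ++ _) size_cat size_compile leq_add2l.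
Qed.

(** Odd arrays hold the input of the enumerator, even arrays from 2 on its memory, and array 0 the
    product. The last clause speaks of the outputs so far, whether or not they are correct. *)
Definition simulates (b tau : nat) (s1 t : config) : Prop :=
  [/\ pc t = b + 13 * pc s1,
      forall r, regs t (24 + r) = regs s1 r,
      [/\ regs t 1 = 1, regs t 2 = 2, regs t 3 = d, regs t 4 = s
        & regs t 19 = s + 2 * d],
      forall a x, memory t a.*2.+1 x = nth 0 (nth [::] ginp a) x /\
                  memory t a.*2.+2 x = memory s1 a x
    & forall i k : 'I_d, memory t 0 (i * d + k) =
        ((s + i, s + 2 * d + k, 2) \in outputs w P ginp tau)].

Lemma simulates_init (t : config) :
  pc t = base -> loop_inv A B weighted (N * N) t ->
  simulates base 0 init_config t.
Proof.
move=> pct [Hr Hm]; split.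
- by rewrite pct muln0 addn0.
- by move=> r; rewrite Hr //=.
- by split; rewrite Hr.
- move=> a x; rewrite !Hm graph_memE //; split=> //.
  by case: a => [|[|[|a]]].
- by move=> i k; rewrite Hm.
Qed.

Lemma step_pad (t : config) (i : instr) : code_at Q (pc t) (pad i) ->
  exists t', [/\ iter 13 (step w Q inp) t = exec w inp t' i,
    pc t' = pc t + 12, forall r, r != 17 -> regs t' r = regs t r
    & memory t' = memory t].
Proof.
move=> Qc; exists (foldl (exec w inp) t (nseq 12 (IConst 17 0))); split.
- by rewrite -foldl_rcons -(@run_code w Q inp (nseq 12 (IConst 17 0)) i t Qc isT).
- by rewrite pc_straight.
- by move=> r nr; rewrite regs_frame //= !inE !(negbTE nr).
- exact: memory_frame.
Qed.

Lemma ginp_lt (a x : nat) : nth 0 (nth [::] ginp a) x < W.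
Proof.
rewrite -graph_memE //.
by have := graph_mem_lt A B d_gt0 weighted a.*2.+1 x (leqnn (N * N)); lia.
Qed.

Lemma step_emit (t : config) (r1 r2 r3 : nat) :
  code_at Q (pc t) (compile base (IEmit r1 r2 r3)) ->
  [/\ regs t 1 = 1, regs t 2 = 2, regs t 3 = d, regs t 4 = s
    & regs t 19 = s + 2 * d] ->
  regs t (24 + r1) < W -> regs t (24 + r2) < W ->
  exists t', [/\ iter 13 (step w Q inp) t = t', pc t' = pc t + 13,
    forall r, ~~ (10 <= r <= 13) -> regs t' r = regs t r,
    forall a x, memory t' a.+1 x = memory t a.+1 x
    & forall i k : 'I_d, memory t' 0 (i * d + k) =
        if (regs t (24 + r1), regs t (24 + r2), regs t (24 + r3))
             == (s + i, s + 2 * d + k, 2)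
        then 1 else memory t 0 (i * d + k)].
Proof.
move=> Qc [E1 E2 E3 E4 E19] lt1 lt2.
exists (foldl (exec w inp) t (compile base (IEmit r1 r2 r3))); split.
- exact: (@run_code w Q inp (take 12 (compile base (IEmit r1 r2 r3)))
                    (IStore 0 10 1) t Qc isT).
- by rewrite pc_straight.
- by move=> r nr; rewrite regs_frame //= !inE; lia.
- by [].
move=> i k; set c := compile _ _.
pose a := (regs t (24 + r1) + (W - s)) %% W.
pose b := (regs t (24 + r2) + (W - (s + 2 * d))) %% W.
pose f := [&& regs t (24 + r3) == 2, a < d & b < d].
have small x : x < W -> x %% W = x by move=> *; rewrite modn_small.
have smallb (c' : bool) : c' %% W = c' by rewrite small //; case: c'; lia.
have Ea : regs (foldl (exec w inp) t (take 12 c)) 10 =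
    if f then a * d + b else W - 1.
  rewrite /= /eval_binop E1 E2 E3 E4 E19 -/a -/b !smallb /f.
  case: (regs t _ == 2) => /=; last first.
    by rewrite !mul0n mod0n mul0n mod0n muln0 mod0n add0n modn_small //; lia.
  case: (ltnP a d) => lta /=; last first.
    by rewrite !muln0 mod0n mul0n mod0n muln0 mod0n add0n modn_small //; lia.
  case: (ltnP b d) => ltb /=; last first.
    by rewrite !muln0 mod0n muln0 mod0n add0n modn_small //; lia.
  rewrite !(muln1, smallb true) (small (a * d)); last by nia.
  rewrite (small (a * d + b)); last by nia.
  rewrite (small (a * d + b + 1)); last by nia.
  rewrite (small (a * d + b + 1)); last by nia.
  by rewrite (_ : a * d + b + 1 + (W - 1) = a * d + b + W) ?modnDr ?small; nia.
have -> : memory (foldl (exec w inp) t c) 0 (i * d + k) =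
  if i * d + k == (if f then a * d + b else W - 1) then 1
  else memory t 0 (i * d + k).
  by rewrite -Ea /= E1.
have lti := ltn_ord i; have ltk := ltn_ord k.
have Ei : (a == i) = (regs t (24 + r1) == s + i).
  by apply: (@modn_sub_eq _ _ _ _ d) => //; lia.
have Ek : (b == k) = (regs t (24 + r2) == s + 2 * d + k).
  by apply: (@modn_sub_eq _ _ _ _ d) => //; lia.
rewrite 2!xpair_eqE -Ei -Ek; congr (if _ then _ else _).
rewrite /f; apply/eqP/andP => [|[/andP[/eqP -> /eqP ->] /eqP ->]]; last first.
  by rewrite lti ltk.
have lt_ik : i * d + k < s.
  rewrite (leq_trans (_ : _ < i.+1 * d)) ?leq_mul2r ?lti ?orbT //.
  by rewrite mulSn addnC ltn_add2r.
case: ifP => [/and3P[-> lta ltb] E|_ E]; last by clear - lt_ik E w_wide; lia.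
have := congr1 (divn^~ d) E; have := congr1 (modn^~ d) E.
rewrite !modnMDl !divnMDl // !modn_small // !divn_small // !addn0 => -> ->.
by rewrite !eqxx.
Qed.

Lemma simulates_step (tau : nat) (t : config) :
  ~~ halted P (config_at w P ginp tau) ->
  simulates base tau (config_at w P ginp tau) t ->
  simulates base tau.+1 (config_at w P ginp tau.+1) (iter 13 (step w Q inp) t).
Proof.
have [] := config_at_bounded w P ginp tau.
have -> : config_at w P ginp tau.+1 =
    exec w ginp (config_at w P ginp tau) (fetch P (config_at w P ginp tau)) by [].
set s1 := config_at _ _ _ tau => bnd _ nh.
have := outputsS w P ginp tau; rewrite -/s1 /emission.
have ltP : pc s1 < size P.
  by rewrite ltnNge; apply: contra nh => le; rewrite /halted /fetch nth_default.
have := code_at_compile ltP; rewrite -/(fetch P s1).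
move: base => b Qc outs [pct rt ct mt ot]; rewrite -pct in Qc; move: Qc outs nh.
(* Shared by the four instructions whose only effect is on a register. *)
have set_ok t' r x : outputs w P ginp tau.+1 = outputs w P ginp tau ++ [::] ->
    pc t' = pc t + 12 -> (forall r', r' != 17 -> regs t' r' = regs t r') ->
    memory t' = memory t ->
    simulates b tau.+1 (set_reg s1 r x) (set_reg t' (24 + r) x).
  move=> outs pct' rt' mt'; split; rewrite /= ?pct' ?mt' ?outs ?cats0 //.
  - by rewrite pct; lia.
  - by move=> r'; rewrite eqn_add2l rt' ?rt.
  - by case: ct => *; split; rewrite rt'.
rewrite /halted; move Eu: (iter 13 _ t) => u.
case: (fetch P s1) => [r c|o r r1 r2|r a i|r a i|a i r|r l|r1 r2 r3|] //= Qc outs _.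
- have [t' [Et pct' rt' mt']] := step_pad Qc; rewrite -Eu Et.
  by apply: set_ok.
- have [t' [Et pct' rt' mt']] := step_pad Qc; rewrite -Eu Et.
  by rewrite /= !rt' // !rt; apply: set_ok.
- have [t' [Et pct' rt' mt']] := step_pad Qc; rewrite -Eu Et.
  rewrite /= mt' !rt' // !rt (mt a (regs s1 i)).1.
  by rewrite (modn_small (ginp_lt _ _)); apply: set_ok.
- have [t' [Et pct' rt' mt']] := step_pad Qc; rewrite -Eu Et.
  by rewrite /= mt' !rt' // !rt (mt a (regs s1 i)).2; apply: set_ok.
- have [t' [Et pct' rt' mt']] := step_pad Qc; rewrite -Eu Et.
  split; rewrite /= ?pct'; first by rewrite pct; lia.
  + by move=> r'; rewrite rt' ?rt.
  + by case: ct => *; split; rewrite rt'.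
  + move=> a' x; rewrite mt' !rt' // !rt !eqSS.
    rewrite (_ : (a'.*2 == a.*2.+1) = false); last by lia.
    by rewrite (inj_eq double_inj) !(mt a' x).1 (mt a' x).2.
  + by move=> i' k; rewrite mt' ot outs cats0.
- have [t' [Et pct' rt' mt']] := step_pad Qc; rewrite -Eu Et.
  split; rewrite /=.
  + by rewrite rt' // rt; case: ifP => _; rewrite ?pct' ?pct; lia.
  + by move=> r'; rewrite rt' ?rt.
  + by case: ct => *; split; rewrite rt'.
  + by move=> a' x; rewrite mt'.
  + by move=> i' k; rewrite mt' ot outs cats0.
have [t' [Et pct' rt' mt' ot']] := step_emit Qc ct
  (leq_ltn_trans (eq_leq (rt r1)) (bnd r1)) (leq_ltn_trans (eq_leq (rt r2)) (bnd r2)).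
rewrite -Eu Et.
split.
- by rewrite /= pct' pct; lia.
- by move=> r'; rewrite rt' ?rt //; lia.
- by case: ct => *; split; rewrite rt'.
- by move=> a x; rewrite !mt'.
move=> i k; rewrite ot' !rt ot outs mem_cat inE eq_sym.
by case: eqP; case: (_ \in _).
Qed.

Lemma simulates_run (T tau : nat) (t : config) :
  (forall tau', tau' < T -> ~~ halted P (config_at w P ginp tau')) ->
  simulates base 0 init_config t -> tau <= T ->
  simulates base tau (config_at w P ginp tau) (iter (13 * tau) (step w Q inp) t).
Proof.
move=> nh sim0; elim: tau => [//|tau IH] letau.
rewrite mulnS iterD; apply: simulates_step; first exact: nh.
exact/IH/ltnW.
Qed.

(** An explicit [IHalt] comes after the 12 fillers of its block; outside the program the machine has
    halted already and stays put. *)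
Lemma simulates_halted (tau : nat) (s1 t : config) :
  halted P s1 -> simulates base tau s1 t ->
  exists t', [/\ iter 12 (step w Q inp) t = t', halted Q t' & memory t' = memory t].
Proof.
move=> hs [pct _ _ _ _]; exists (iter 12 (step w Q inp) t).
case: (ltnP (pc s1) (size P)) => ltP; last first.
  have ht : halted Q t by rewrite /halted /fetch pct multiplier_end.
  by rewrite halted_iter.
have := code_at_compile ltP; rewrite -/(fetch P s1) -pct.
move: hs; rewrite /halted; case: (fetch P s1) => // _ Qc.
have Q12 : code_at Q (pc t) (nseq 12 (IConst 17 0)).
  by move=> j ltj; rewrite Qc ?nth_rcons ?ltj // ltnW.
rewrite (@run_straight w Q inp _ t Q12 isT); split; [by []| |exact: memory_frame].
by rewrite /fetch pc_straight // Qc.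
Qed.

Lemma multiplier_spec (T : nat) : halts_at w P ginp T ->
  let T' := size (prologue weighted) + (size loop_body).+1 * (N * N) + 13 * T + 12 in
  let t := config_at w Q inp T' in
  halted Q t /\
  forall i k : 'I_d, memory t 0 (i * d + k) =
    ((s + i, s + 2 * d + k, 2) \in outputs w P ginp T).
Proof.
case=> hT nh.
have [pct inv] := setup_spec A B d_gt0 w_wide code_at_setup.
have simT := simulates_run nh (simulates_init pct inv) (leqnn T).
have [t' [Et' ht' mt']] := simulates_halted hT simT.
have split_time T0 : config_at w Q inp (T0 + 13 * T + 12) =
    iter 12 (step w Q inp) (iter (13 * T) (step w Q inp) (config_at w Q inp T0)).
  by rewrite /config_at -!iterD; congr (iter _ _ _); lia.
cbv zeta; rewrite split_time Et' mt'; split=> //.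
by case: simT.
Qed.

End Simulation.

(** * Counting steps *)

Section Counting.

Variables (d : nat) (A B : 'M[bool]_d).
Hypothesis d_gt0 : 0 < d.

Local Notation G := (layered_graph A B).
Local Notation s := (d * d).
Local Notation N := (3 * d).
Local Notation n := (d * d + 3 * d).

(** A pair determines its distance, so outputs are at most as many as reachable pairs: [n] on the
    diagonal, and off it both ends lie among the [N] layer vertices. *)
Lemma size_enumeration (w : nat) (P : program) (inp : input) (T : nat) :
  enumerates_reachable_apsd G w P inp T -> size (outputs w P inp T) <= n + N * N.
Proof.
case=> uo mo; set o := outputs _ _ _ _ in uo mo *.
have -> : n + N * N = size ([seq (x, x) | x <- iota 0 n] ++
                            [seq (s + x, s + y) | x <- iota 0 N, y <- iota 0 N]).
  by rewrite size_cat size_allpairs size_map !size_iota.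
rewrite -(size_map fst); apply: uniq_leq_size.
  rewrite map_inj_in_uniq // => [[[x y] k] [[x' y'] k']] /mo[u [v [-> -> D]]].
  case/mo=> u' [v' [-> -> D']] [/ord_inj Eu /ord_inj Ev]; subst u' v'.
  by rewrite (dist_uniq D D').
move=> [x y] /mapP[[[x' y'] k] /mo[u [v [-> -> D]]] [-> ->]].
rewrite mem_cat; case: (eqVneq u v) => [->|neq].
  by rewrite map_f // mem_iota /=.
have /andP[leu lev] := dist_layered_ge d_gt0 D neq; apply/orP; right.
apply/allpairsP; exists (u - s, v - s); rewrite !mem_iota /= !subnKC //.
by split=> //; have := ltn_ord u; have := ltn_ord v; rewrite /=; lia.
Qed.

(** At most [9 * d ^ 2] arcs are shared by more than [d ^ 2] vertices, thanks to the isolated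
    ones. *)
Lemma avg_degree_layered : (avg_degree G <= 9%:R)%R.
Proof.
rewrite /avg_degree ler_pdivrMr ?ltr0n /=; last by lia.
rewrite -natrM ler_nat sum_degree_layered //.
by apply: leq_trans (size_arcs A B _) _; lia.
Qed.

Lemma output_layered (w : nat) (P : program)
    (inp : input) (T : nat) (i k : 'I_d) :
  enumerates_reachable_apsd G w P inp T ->
  ((s + i, s + 2 * d + k, 2) \in outputs w P inp T) = bool_mulmx A B i k.
Proof.
case=> _ mo.
have ltu : s + i < n by have := ltn_ord i; lia.
have ltv : s + 2 * d + k < n by have := ltn_ord k; lia.
have D := dist_layered2 A B d_gt0 (u := Ordinal ltu) (v := Ordinal ltv) erefl erefl.
apply/idP/idP => [/mo[u [v [Eu Ev Duv]]]|/D Duv].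
  apply/D; rewrite (_ : Ordinal ltu = u); last exact: ord_inj.
  by rewrite (_ : Ordinal ltv = v); last exact: ord_inj.
by apply/mo; exists (Ordinal ltu), (Ordinal ltv).
Qed.

End Counting.

Theorem theorem13 (directed weighted : bool) :
  ~ (exists Q : program, multiplies_in_quadratic_time Q) ->
  ~ (exists P : program, solves_reachable_apsd directed weighted P).
Proof.
move=> noQ [P [kappa [c solP]]]; apply: noQ.
(* The fourth power of [d + 2] dominates the size of the graph; [kappa.+1] provides for its
   [kappa]-th power and for its first power, which the multiplier needs. In the time bound,
   [491 = 11 + 52 * 9 + 12] counts the prologue, the loop and the final halt, and [1989 = 13 * 153]
   the simulated steps. *)
exists (multiplier weighted P), (4 * kappa.+1), (491 + 1989 * c).
move=> d A B w d_gt0 wide inp.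
set G := layered_graph A B.
have num_le : num_edges directed G <= 3 * d * (3 * d).
  exact: num_edges_layered.
have wide4 : (d + 2) ^ 4 <= 2 ^ w.
  by apply: leq_trans wide; rewrite leq_pexp2l ?addn2 //; lia.
have big : d * d + 3 * d + 3 * d * (3 * d) + 3 <= (d + 2) ^ 4.
  by rewrite !expnS expn0; nia.
have wideG : wide_enough kappa (nvert G + num_edges directed G + max_weight G + 2) w.
  apply: leq_trans wide; rewrite expnM.
  apply: leq_trans (_ : ((d + 2) ^ 4) ^ kappa <= _); last first.
    by rewrite leq_pexp2l // expn_gt0 addn2.
  have mw : max_weight G <= 1 := max_weight_layered A B.
  by case: (kappa) => // k; rewrite leq_exp2r // [nvert G]/(d * d + 3 * d); lia.
have [T [p [hT enumT [lepT _] lep ledelay]]] :=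
  solP G w (layered_graph_valid A B d_gt0 directed weighted) wideG.
have delay_le : delay p (output_times w P (encode_graph weighted G) T) T <= c * 10.
  rewrite -(ler_nat rat); apply: le_trans ledelay _.
  rewrite natrM ler_wpM2l ?ler0n // -[10]/(1 + 9)%N natrD lerD2l.
  exact: avg_degree_layered.
(* Here [153 = 13 + 14 * 10]: preprocessing takes at most [13 * c * d ^ 2] steps, followed by at
   most [14 * d ^ 2] gaps of at most [10 * c] steps. *)
have T_le : T <= 153 * c * d ^ 2.
  have := time_delay p (output_times w P (encode_graph weighted G) T) T.
  have := size_enumeration d_gt0 enumT; rewrite size_outputs.
  set D := delay _ _ _ in delay_le *; set k := size _ => le_k le_T.
  have le_k14 : k.+1 <= 14 * d ^ 2 by rewrite expnS expn1; nia.
  have le_p : p <= c * (13 * d ^ 2).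
    by apply: leq_trans lep _; rewrite leq_mul2l expnS expn1 /=; apply/orP; right; nia.
  have := leq_mul le_k14 delay_le; lia.
have [hQ memQ] := multiplier_spec d_gt0 (leq_trans big wide4) hT.
have [T' [leT' hT' eqT']] := halts_before hQ.
exists T'; split=> //; last first.
  by move=> i k; rewrite eqT' memQ (output_layered d_gt0 _ _ enumT).
apply: leq_trans leT' _.
have d2 : 0 < d ^ 2 by rewrite expn_gt0 d_gt0.
rewrite (_ : 3 * d * (3 * d) = 9 * d ^ 2); last by rewrite expnS expn1; lia.
have -> : size (prologue weighted) = 11 by [].
have -> : size loop_body = 51 by [].
move: (d ^ 2) d2 T_le => q; nia.
Qed.
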